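(* Under the token-level detector $\gamma_{\mathrm{tk}}(X_1^T,\zeta_1^T)=\mathbf 1\{\frac1T\sum_{t=1}^T\mathbf 1\{X_t=g_{\mathrm{tk}}(\zeta_t)\}\ge\lambda\}$ and its corresponding token-level optimal watermarking scheme with token-level false-positive level $\eta\in(0,1)$, the expected number of tokens that can be randomly replaced in $X_1^T$ without compromising detection performance is $$\sum_{t=1}^T\mathbb E_{X_1^{t-1}}\Big[\sum_{x\in\mathcal V}\big(P^*_{X_t|X_1^{t-1}}(x|X_1^{t-1})-\eta\big)_+\Big].$$
   Context: Notation: $(x)_+=\max\{x,0\}$; $x\wedge y=\min\{x,y\}$; $\mathcal V$ is a finite vocabulary with $|\mathcal V|\ge2$; $T\ge1$; $\lambda>0$. The function $g_{\mathrm{tk}}:\mathcal Z\to\mathcal S$ is a bijection onto a set $\mathcal S\supsetneq\mathcal V$, with $\mathcal Z=g_{\mathrm{tk}}^{-1}(\mathcal V)\cup\{\tilde\zeta\}$, where the redundant value $\tilde\zeta$ satisfies $g_{\mathrm{tk}}(\tilde\zeta)\notin\mathcal V$. Token-level optimal watermarking scheme with level $\eta$: the original language model has next-token distributions $Q_{X_t|x_1^{t-1}}$ on $\mathcal V$, and $\mathsf D$ is a distortion function on $\mathcal P(\mathcal V)$ (nonnegative, $\mathsf D(\mu,\mu)=0$) with level $\epsilon\ge0$. For each $t$ and each prefix $x_1^{t-1}$, let $$P^*_{X_t|x_1^{t-1}}=\operatorname*{arg\,min}_{P:\ \mathsf D(P,Q_{X_t|x_1^{t-1}})\le\epsilon}\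 \sum_{x\in\mathcal V}(P(x)-\eta)_+,$$ and, conditionally on the past $(x_1^{t-1},\zeta_1^{t-1})$, let $(X_t,\zeta_t)$ have joint law $\Pr(X_t=x,\zeta_t=g_{\mathrm{tk}}^{-1}(x))=P^*_{X_t|x_1^{t-1}}(x)\wedge\eta$, $\Pr(X_t=x,\zeta_t=\tilde\zeta)=(P^*_{X_t|x_1^{t-1}}(x)-\eta)_+$ for $x\in\mathcal V$, and zero mass on all other pairs. Replaceability: the auxiliary sequence $\zeta_1^T$ is shared between the language model and the detector and stays fixed when tokens of $X_1^T$ are replaced. The token at position $t$ can be replaced without compromising detection if, for every $x\in\mathcal V$, $\mathbf 1\{x=g_{\mathrm{tk}}(\zeta_t)\}=\mathbf 1\{X_t=g_{\mathrm{tk}}(\zeta_t)\}$, i.e. replacing $X_t$ by any token leaves its contribution to the detector's score unchanged. The claim concerns the expected number of such positions $t\in\{1,\dots,T\}$ under the token-level optimal scheme. *)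

(* Defs.v *)
From HB Require Import structures.
From mathcomp Require Import all_boot all_order all_algebra.
From mathcomp Require Import all_classical all_reals all_analysis.

Set Implicit Arguments.
Unset Strict Implicit.
Unset Printing Implicit Defensive.

Import Order.TTheory GRing.Theory Num.Theory.

Local Open Scope classical_set_scope.
Local Open Scope ring_scope.

Record dist (R : realType) (V : finType) := Dist {
  pmf :> V -> R ;
  pmf_ge0 : forall x, 0 <= pmf x ;
  pmf_sum1 : \sum_(x : V) pmf x = 1 }.

(* The inclusion of the vocabulary V in S is the injection iota; zt is the
   redundant auxiliary value. *)
Definition tk_key_space (V S Z : finType) (iota : V -> S) (g : Z -> S)
    (zt : Z) : Prop :=
  [/\ injective iota,
      exists s : S, s \notin codom iota,
      bijective g,
      forall z : Z, g z \in codom iota \/ z = zt &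
      g zt \notin codom iota].

(* Distortions may take the value +oo (e.g. the Kullback-Leibler
   divergence). *)
Definition distortion (R : realType) (V : finType)
    (D : dist R V -> dist R V -> \bar R) : Prop :=
  (forall mu nu, (0 <= D mu nu)%E) /\ (forall mu, D mu mu = 0%E).

Definition excess (R : realType) (V : finType) (eta : R) (p : dist R V) : R :=
  \sum_(x : V) Num.max (p x - eta) 0.

(* p is one of the minimizers; uniqueness is not required. *)
Definition is_argmin_excess (R : realType) (V : finType)
    (D : dist R V -> dist R V -> \bar R) (q : dist R V) (eps eta : R)
    (p : dist R V) : Prop :=
  (D p q <= eps%:E)%E /\
  (forall p' : dist R V, (D p' q <= eps%:E)%E -> excess eta p <= excess eta p').

(* As g is bijective, g z == iota x says that z is the g-preimage of x; this
   excludes z = zt, whose image lies outside of the vocabulary. *)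
Definition tk_kernel (R : realType) (V S Z : finType) (iota : V -> S)
    (g : Z -> S) (zt : Z) (eta : R) (p : dist R V) (x : V) (z : Z) : R :=
  if g z == iota x then Num.min (p x) eta
  else if z == zt then Num.max (p x - eta) 0
  else 0.

Definition cond_prob (d : measure_display) (Omega : measurableType d)
    (R : realType) (P : probability Omega R) (A B : set Omega) : R :=
  fine (P (A `&` B)) / fine (P B).

Definition past (Omega : Type) (V Z : finType) (T : nat)
    (X : Omega -> T.-tuple V) (zeta : Omega -> T.-tuple Z)
    (t : nat) (hx : t.-tuple V) (hz : t.-tuple Z) : set Omega :=
  [set w | take t (X w) = hx /\ take t (zeta w) = hz].

(* Positions are numbered from 0, so the past of position t : 'I_T consists of
   the first t entries of both sequences. pstar h is the next-token law after
   the prefix h. *)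
Definition tk_scheme (d : measure_display) (Omega : measurableType d)
    (R : realType) (P : probability Omega R) (V S Z : finType)
    (iota : V -> S) (g : Z -> S) (zt : Z) (eta : R) (pstar : seq V -> dist R V)
    (T : nat) (X : Omega -> T.-tuple V) (zeta : Omega -> T.-tuple Z) : Prop :=
  (forall xs zs, measurable [set w | X w = xs /\ zeta w = zs]) /\
  (forall (t : 'I_T) (hx : t.-tuple V) (hz : t.-tuple Z) (x : V) (z : Z),
     P (past X zeta hx hz) != 0%E ->
     cond_prob P [set w | tnth (X w) t = x /\ tnth (zeta w) t = z]
                 (past X zeta hx hz)
     = tk_kernel iota g zt eta (pstar hx) x z).

(* A detector that thresholds the average of per-position contributions. *)
Record score_detector (R : realType) (V Z : finType) := ScoreDetector {
  contribution : V -> Z -> bool ;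
  threshold : R }.

Definition detect (R : realType) (V Z : finType) (gamma : score_detector R V Z)
    (T : nat) (xs : T.-tuple V) (zs : T.-tuple Z) : bool :=
  threshold gamma <=
    T%:R^-1 * \sum_(t < T) (contribution gamma (tnth xs t) (tnth zs t))%:R.

Definition gamma_tk (R : realType) (V S Z : finType) (iota : V -> S)
    (g : Z -> S) (lambda : R) : score_detector R V Z :=
  ScoreDetector (fun x z => iota x == g z) lambda.

(* The auxiliary value at position t is kept while the token is replaced. *)
Definition replaceable (R : realType) (V Z : finType)
    (gamma : score_detector R V Z) (T : nat)
    (xs : T.-tuple V) (zs : T.-tuple Z) (t : 'I_T) : bool :=
  [forall x : V, contribution gamma x (tnth zs t)
                 == contribution gamma (tnth xs t) (tnth zs t)].

Definition nb_replaceable (R : realType) (V Z : finType)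
    (gamma : score_detector R V Z) (T : nat)
    (xs : T.-tuple V) (zs : T.-tuple Z) : nat :=
  #|[pred t : 'I_T | replaceable gamma xs zs t]|.

(* Main.v *)
Require Import Defs.
From HB Require Import structures.
From mathcomp Require Import all_boot all_order all_algebra.
From mathcomp Require Import all_classical all_reals all_analysis.

Import Order.TTheory GRing.Theory Num.Theory.

Local Open Scope ring_scope.

(* The token at position t is replaceable exactly when zeta_t is the redundant
   value.  Given the past, this event has probability equal to the excess mass
   of the next-token law, so it suffices to condition each position on its past
   and to sum over the positions. *)

Lemma preimage_pred_measurable {d} {Omega : measurableType d} {F : finType}
    (W : Omega -> F) (Q : pred F) :
  (forall a, measurable [set w | W w = a]%classic) ->
  measurable [set w | Q (W w)]%classic.
Proof.
move=> mW.
have -> : [set w | Q (W w)]%classic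
    = (\bigcup_(a in [set a | Q a]) [set w | W w = a])%classic.
  apply/seteqP; split=> [w Qw|w [a Qa /= ->]] //.
  by exists (W w).
exact: fin_bigcup_measurable.
Qed.

(** Since [F] is finite, [f (W w)] is a finite linear combination of indicators of the fibres of
    [W], and integration is linear. No measurable structure on [F] is used, only measurability of
    the fibres. *)
Lemma expectation_finite {d} {Omega : measurableType d} {R : realType}
    (P : probability Omega R) {F : finType} (W : Omega -> F) (f : F -> R) :
  (forall a, measurable [set w | W w = a]%classic) ->
  ('E_P[fun w => f (W w)]
   = (\sum_(a : F) f a * fine (P [set w | W w = a]%classic))%:E)%E.
Proof.
move=> mW; rewrite unlock.
under eq_integral => w _.
  rewrite (_ : f (W w) = \sum_a f a * \1_[set u | W u = a]%classic w); last first.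
    rewrite (bigD1 (W w)) //= big1 ?addr0 => [|a aW].
      by rewrite indicE mem_set ?mulr1.
    by rewrite indicE memNset ?mulr0 //= => Wa; rewrite Wa eqxx in aW.
  rewrite -sumEFin; under eq_bigr => a _ do rewrite EFinM.
  over.
rewrite integral_sum //=; last first.
  by move=> a; apply: integrableZl => //; exact: integrable_indic.
rewrite -sumEFin; apply: eq_bigr => a _.
rewrite integralZl //; last exact: integrable_indic.
by rewrite integral_indic // setIT EFinM fineK // fin_num_measure.
Qed.

Lemma measurable_pair_fiber {d} {Omega : measurableType d} {A B : Type}
    (Y : Omega -> A) (Z : Omega -> B) :
  (forall a b, measurable [set w | Y w = a /\ Z w = b]%classic) ->
  forall c, measurable [set w | (Y w, Z w) = c]%classic.
Proof.
move=> mYZ [a b].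
rewrite (_ : mkset _ = [set w | Y w = a /\ Z w = b]%classic) //.
by apply/seteqP; split=> w /= [-> ->].
Qed.

Lemma probability_finite {d} {Omega : measurableType d} {R : realType}
    (P : probability Omega R) {F : finType} (W : Omega -> F) (Q : pred F) :
  (forall a, measurable [set w | W w = a]%classic) ->
  fine (P [set w | Q (W w)]%classic)
  = \sum_(a | Q a) fine (P [set w | W w = a]%classic).
Proof.
move=> mW.
rewrite -(expectation_indic P (preimage_pred_measurable _ Q mW)).
rewrite (_ : \1__ = fun w => (Q (W w))%:R); last first.
  apply/funext => w; rewrite indicE; congr (_%:R); congr nat_of_bool.
  by apply/idP/idP; rewrite in_setE.
rewrite (expectation_finite P _ (fun a => (Q a)%:R) mW) /= [RHS]big_mkcond /=.
by apply: eq_bigr => a _; case: (Q a); rewrite ?mul1r ?mul0r.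
Qed.

(** The product rule, extended to null events: if [P B] is zero, both sides vanish by monotonicity.
    This covers the pasts of probability zero, on which the scheme imposes nothing. *)
Lemma fine_cond_prob {d} {Omega : measurableType d} {R : realType}
    (P : probability Omega R) (A B : set Omega) (r : R) :
  measurable A -> measurable B -> (P B != 0%E -> cond_prob P A B = r) ->
  fine (P (A `&` B)%classic) = r * fine (P B).
Proof.
move=> mA mB; have [PB0 _|PB0 /(_ isT) <-] := eqVneq (P B) 0%E.
  rewrite PB0 mulr0; suff -> : P (A `&` B)%classic = 0%E by [].
  apply/eqP; rewrite eq_le measure_ge0 andbT -PB0.
  by apply: le_measure; rewrite ?inE //; exact: measurableI.
by rewrite /cond_prob divfK // fine_eq0 // fin_num_measure.
Qed.

(** At [zt] no token matches, so the contribution is constantly false. Any other auxiliary value is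
    matched by exactly one token [y], and as there are at least two tokens, some replacement flips
    the contribution. *)
Lemma replaceable_gamma_tk {R : realType} {V S Z : finType} {iota : V -> S}
    {g : Z -> S} {zt : Z} (lambda : R) {T : nat} (xs : T.-tuple V)
    (zs : T.-tuple Z) (t : 'I_T) :
  (2 <= #|V|)%N -> tk_key_space iota g zt ->
  replaceable (gamma_tk iota g lambda) xs zs t = (tnth zs t == zt).
Proof.
move=> V2 [iota_inj _ _ gV gzt]; rewrite /replaceable /=.
have gztN x : (iota x == g zt) = false.
  by apply: contraNF gzt => /eqP <-; exact: codom_f.
have [->|zN] := eqVneq (tnth zs t) zt.
  by apply/forallP => x; rewrite !gztN.
case: (gV (tnth zs t)) => [/codomP[y gy]|/eqP]; last by rewrite (negPf zN).
apply/negbTE/forallPn => /=.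
have [x yx] : exists x, x != y.
  apply/existsP; rewrite -[[exists _, _]]negbK; apply/negP => /existsPn allV.
  move: V2; rewrite ltnNge => /negP; apply.
  rewrite -(card1 y); apply/subset_leq_card/fintype.subsetP => z _.
  by move: (allV z); rewrite negbK inE.
(* A matching token is spoiled by replacing it with [x]; a non-matching one becomes matching when
   replaced with [y]. *)
rewrite gy; have [yt|yt] := eqVneq (iota (tnth xs t)) (iota y).
  by exists x; rewrite (inj_eq iota_inj) (negPf yx).
by exists y; rewrite eqxx.
Qed.

Lemma tk_kernel_redundant {R : realType} {V S Z : finType} {iota : V -> S}
    {g : Z -> S} {zt : Z} (eta : R) (p : dist R V) (x : V) :
  g zt \notin codom iota ->
  tk_kernel iota g zt eta p x zt = Num.max (p x - eta) 0.
Proof.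
move=> gzt; rewrite /tk_kernel eqxx ifN //.
by apply: contraNneq gzt => ->; exact: codom_f.
Qed.

(** The cast turns length [minn t T] into [t], so that prefixes over a finite alphabet range over a
    finite type and index the pasts of the scheme. *)
Definition tuple_prefix {A : Type} {T : nat} (t : 'I_T) (s : T.-tuple A) :
    t.-tuple A :=
  tcast (minn_idPl (ltnW (ltn_ord t))) [tuple of take t s].

Lemma val_tuple_prefix {A : Type} {T : nat} (t : 'I_T) (s : T.-tuple A) :
  tuple_prefix t s = take t s :> seq A.
Proof. by rewrite val_tcast. Qed.

(** The law of total probability over the past and the current token; summing the kernel at [zt]
    over tokens gives the excess. *)
Lemma probability_redundant {R : realType} {V S Z : finType} {iota : V -> S}
    {g : Z -> S} {zt : Z} {T : nat} {eta : R} {pstar : seq V -> dist R V}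
    {d : measure_display} {Omega : measurableType d} {P : probability Omega R}
    {X : Omega -> T.-tuple V} {zeta : Omega -> T.-tuple Z} (t : 'I_T) :
  g zt \notin codom iota ->
  tk_scheme P iota g zt eta pstar X zeta ->
  let pr a := fine (P [set w | (X w, zeta w) = a]%classic) in
  \sum_(a : T.-tuple V * T.-tuple Z | tnth a.2 t == zt) pr a
  = \sum_(a : T.-tuple V * T.-tuple Z) excess eta (pstar (take t a.1)) * pr a.
Proof.
move=> gzt [mXz cXz] pr; pose W w := (X w, zeta w).
have mW a : measurable [set w | W w = a]%classic.
  exact: (measurable_pair_fiber _ _ mXz).
pose hist (a : T.-tuple V * T.-tuple Z) :=
  (tuple_prefix t a.1, tuple_prefix t a.2).
have pastE b : past X zeta b.1 b.2 = [set w | hist (W w) == b]%classic.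
  apply/seteqP; split=> w /= => [[bX bz]|/eqP <-]; last first.
    by split; rewrite /= val_tuple_prefix.
  apply/eqP; rewrite [RHS]surjective_pairing.
  by congr (_, _); apply/val_inj; rewrite /= val_tuple_prefix.
(* The joint mass of past [b], token [x] and value [zt] at position [t] is the kernel value times
   the mass of the past. *)
have step b x :
    \sum_(a | (tnth a.2 t == zt) && (hist a == b) && (tnth a.1 t == x)) pr a
    = Num.max (pstar b.1 x - eta) 0 * \sum_(a | hist a == b) pr a.
  rewrite -!(probability_finite P _ _ mW) -(tk_kernel_redundant _ _ _ gzt).
  pose A := [pred a : T.-tuple V * T.-tuple Z |
    (tnth a.1 t == x) && (tnth a.2 t == zt)].
  have AE : [set w | tnth (X w) t = x /\ tnth (zeta w) t = zt]%classic
      = [set w | A (W w)]%classic.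
    apply/seteqP; split=> w /= => [[-> ->]|/andP[/eqP -> /eqP ->]] //.
    by rewrite !eqxx.
  rewrite -(@fine_cond_prob _ _ _ _ [set w | A (W w)]%classic); first last.
  - by rewrite -AE -pastE; exact: cXz.
  - exact: (preimage_pred_measurable _ (fun a => hist a == b) mW).
  - exact: preimage_pred_measurable.
  congr (fine (P _)); apply/seteqP; split=> w /=.
    by move=> /andP[/andP[-> ->] ->].
  by move=> [/andP[-> ->] ->].
rewrite (partition_big hist predT) //= [RHS](partition_big hist predT) //=.
apply: eq_bigr => b _.
rewrite (partition_big (fun a => tnth a.1 t) predT) //=.
under eq_bigr => x _ do rewrite step.
(* The excess depends only on the token prefix, hence is constant on each class of sequences with
   the same past. *)
rewrite -mulr_suml mulr_sumr; apply: eq_bigr => a /eqP <-.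
by rewrite val_tuple_prefix.
Qed.

Theorem proposition4 (R : realType) (V S Z : finType)
    (iota : V -> S) (g : Z -> S) (zt : Z) (T : nat) (lambda eta eps : R)
    (D : dist R V -> dist R V -> \bar R) (q pstar : seq V -> dist R V)
    (d : measure_display) (Omega : measurableType d) (P : probability Omega R)
    (X : Omega -> T.-tuple V) (zeta : Omega -> T.-tuple Z)
    (hV : (2 <= #|V|)%N) (hT : (1 <= T)%N) (hlambda : 0 < lambda)
    (heta0 : 0 < eta) (heta1 : eta < 1) (heps : 0 <= eps)
    (hkey : tk_key_space iota g zt)
    (hD : distortion D)
    (hpstar : forall h : seq V, (size h < T)%N ->
       is_argmin_excess D (q h) eps eta (pstar h))
    (hscheme : tk_scheme P iota g zt eta pstar X zeta) :
  ('E_P[fun w => (nb_replaceable (gamma_tk iota g lambda) (X w) (zeta w))%:R]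
   = \sum_(t < T)
       'E_P[fun w => (\sum_(x : V)
              Num.max (pstar (take t (X w)) x - eta) 0)%R])%E.
Proof.
have [_ _ _ _ gzt] := hkey.
have mW (a : T.-tuple V * T.-tuple Z) :
    measurable [set w | (X w, zeta w) = a]%classic.
  exact: (measurable_pair_fiber _ _ hscheme.1).
rewrite (expectation_finite P (fun w => (X w, zeta w)) (fun a =>
  (nb_replaceable (gamma_tk iota g lambda) a.1 a.2)%:R) mW).
under [RHS]eq_bigr => t _.
  rewrite (expectation_finite P (fun w => (X w, zeta w))
    (fun a => excess eta (pstar (take t a.1))) mW).
  rewrite -(probability_redundant t gzt hscheme).
  over.
rewrite sumEFin; congr (_%:E).
(* Linearity of expectation: exchanging the sums leaves, for each outcome [a], the count of
   positions whose auxiliary value is [zt]. *)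
under [RHS]eq_bigr => t _ do rewrite big_mkcond.
rewrite exchange_big /=; apply: eq_bigr => a _.
rewrite /nb_replaceable -sum1_card natr_sum mulr_suml big_mkcond /=.
apply: eq_bigr => t _.
by rewrite inE (replaceable_gamma_tk _ _ _ _ hV hkey) mul1r.
Qed.
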